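(* Let $F$ be a positive integer. The following procedure, applied to the input $F$, returns the set $\mathrm{Arf}(F)$ of all A-semigroups with Frobenius number $F$. (1) Set $\Delta=\langle F+1,\dots,2F+1\rangle$, $\mathcal{A}=\{\Delta\}$ and $B=\{\Delta\}$. (2) For every $S\in B$, compute $\theta(S)=\{x\in\mathrm{SG}(S)\mid x<\mathrm{m}(S),\ x\neq F \text{ and } S\cup\{x\}\text{ is a MED-semigroup}\}$. (3) If $\bigcup_{S\in B}\theta(S)=\emptyset$, then return $\mathcal{A}$. (4) Set $C=\bigcup_{S\in B}\{S\cup\{x\}\mid x\in\theta(S)\}$. (5) For all $S\in C$ compute $\mathrm{msg}(S)$. (6) Replace $\mathcal{A}$ by $\mathcal{A}\cup C$, replace $B$ by $C$, and go to step (2).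
   Context: $\mathbb{N}$ denotes the set of nonnegative integers. A numerical semigroup is a subset $S\subseteq\mathbb{N}$ that contains $0$, is closed under addition, and has finite complement in $\mathbb{N}$. For integers $n_1,\dots,n_p\in\mathbb{N}$, $\langle n_1,\dots,n_p\rangle=\{\sum_{i}\lambda_i n_i\mid \lambda_1,\dots,\lambda_p\in\mathbb{N}\}$. Every numerical semigroup $S$ has a unique minimal system of generators, denoted $\mathrm{msg}(S)$, which is finite; its cardinality is the embedding dimension $\mathrm{e}(S)$. The multiplicity is $\mathrm{m}(S)=\min(S\setminus\{0\})$, and the Frobenius number $\mathrm{F}(S)$ is the greatest integer not in $S$. A MED-semigroup is a numerical semigroup $S$ with $\mathrm{e}(S)=\mathrm{m}(S)$. An A-semigroup (Arf numerical semigroup) is a numerical semigroup $S$ such that $x+y-z\in S$ for all $x,y,z\in S$ with $x\ge y\ge z$. $\mathrm{Arf}(F)$ is the set of A-semigroups with Frobenius number $F$. The set of pseudo-Frobenius numbers of $S$ is $\mathrm{PF}(S)=\{z\in\mathbb{Z}\setminus S\mid z+s\in S\text{ for all }s\in S\setminus\{0\}\}$, and the set of special gaps is $\mathrm{SG}(S)=\{x\in\mathrm{PF}(S)\mid 2x\in S\}$ (for a gap $x\in\mathbb{N}\setminus S$, $x\in\mathrm{SG}(S)$ if and only if $S\cup\{x\}$ is a numerical semigroup).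
   Formalization: In step (6), ''Replace 𝒜 by 𝒜 ∩ C'' is read as ''Replace 𝒜 by 𝒜 ∪ C''; with the intersection the claim fails, e.g. for F = 3 the procedure would return the empty set although Arf(3) contains Δ. *)

(* Defs.v *)
From mathcomp Require Import all_boot all_order all_algebra finmap.
From mathcomp Require Import all_classical.

Set Implicit Arguments.
Unset Strict Implicit.
Unset Printing Implicit Defensive.

Local Open Scope classical_set_scope.

Definition numerical_semigroup (S : set nat) : Prop :=
  [/\ S 0, forall x y, S x -> S y -> S (x + y) & finite_set (~` S)].

(* The submonoid of nat generated by X, which may be infinite: all
   combinations of finitely many elements of X. *)
Definition generated (X : set nat) : set nat :=
  [set x | exists (Y : {fset nat}) (l : nat -> nat),
      [set` Y] `<=` X /\ x = \sum_(n <- Y) l n * n].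

Definition minimal_generators (S X : set nat) : Prop :=
  generated X = S /\ forall Y, Y `<=` X -> generated Y = S -> Y = X.

(* Each xget below selects the unique element of its set when there is one;
   the default value is never reached on a numerical semigroup. *)
Definition msg (S : set nat) : set nat := xget set0 [set X | minimal_generators S X].

Definition embedding_dim (S : set nat) : nat := #|` fset_set (msg S)|%fset.

Definition multiplicity (S : set nat) : nat :=
  xget 0 [set m | (S `\ 0) m /\ forall s, (S `\ 0) s -> m <= s].

Definition intset (S : set nat) : set int := [set Posz n | n in S].

(* Integer-valued because the semigroup of all naturals has Frobenius number -1. *)
Definition frobenius (S : set nat) : int :=
  xget (-1)%R [set z | ~ intset S z /\ forall y, ~ intset S y -> (y <= z)%R].

Definition MED_semigroup (S : set nat) : Prop :=
  numerical_semigroup S /\ embedding_dim S = multiplicity S.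

Definition A_semigroup (S : set nat) : Prop :=
  numerical_semigroup S /\
  forall x y z, S x -> S y -> S z -> z <= y <= x -> S (x + y - z).

Definition Arf (F : nat) : set (set nat) :=
  [set S | A_semigroup S /\ frobenius S = Posz F].

Definition PF (S : set nat) : set int :=
  [set z | ~ intset S z /\ forall s, (S `\ 0) s -> intset S (z + Posz s)%R].

Definition SG (S : set nat) : set int :=
  [set x | PF S x /\ intset S (2 * x)%R].

(* Ranging over x : nat loses nothing: 2 x \in S forces x >= 0 in SG S. *)
Definition theta (F : nat) (S : set nat) : set nat :=
  [set x | [/\ SG S (Posz x), x < multiplicity S, x <> F
             & MED_semigroup (S `|` [set x])]].

Definition Delta (F : nat) : set nat :=
  generated [set n | F.+1 <= n <= 2 * F + 1].

Definition extensions (F : nat) (B : set (set nat)) : set (set nat) :=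
  \bigcup_(S in B) [set S `|` [set x] | x in theta F S].

(* run F A B R: with current values A and B at the head of the loop, the
   procedure terminates and returns R; being inductive, run only holds of
   terminating executions.  M records the minimal systems of generators computed
   for the new semigroups; they are finite, and do not affect A and B. *)
Inductive run (F : nat) : set (set nat) -> set (set nat) -> set (set nat) -> Prop :=
| run_return A B :
    \bigcup_(S in B) theta F S = set0 -> run F A B A
| run_loop A B R (M : set nat -> {fset nat}) :
    \bigcup_(S in B) theta F S <> set0 ->
    (forall S, extensions F B S -> minimal_generators S [set` M S]) ->
    run F (A `|` extensions F B) (extensions F B) R ->
    run F A B R.

Definition returns (F : nat) (R : set (set nat)) : Prop :=
  run F [set Delta F] [set Delta F] R.

(* Main.v *)
Require Import Defs.
From mathcomp Require Import all_boot all_order all_algebra finmap.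
From mathcomp Require Import all_classical.
From mathcomp Require Import zify.

Set Implicit Arguments.
Unset Strict Implicit.
Unset Printing Implicit Defensive.

Local Open Scope classical_set_scope.

(** The semigroups in [Arf F] form a finite tree rooted at [Delta F], in which
the parent of [T] is [T] without its multiplicity; the procedure explores this
tree level by level.

Removing the multiplicity [m] of an Arf semigroup leaves an Arf semigroup, with
the same Frobenius number as long as [m <= F]; the one semigroup of [Arf F] with
[F < m] is [Delta F]. The removed element is in [theta] of the parent, because
Arf semigroups have maximal embedding dimension ([Arf_parent]).

Conversely the children computed by the procedure are all Arf ([theta_Arf]). The
MED property with multiplicity [m] means that [a + b - m] stays in the semigroup
for nonzero [a] and [b] ([MED_semigroupP]). That is the Arf condition with [m]
as its least element, so it is exactly what must be checked when a new
multiplicity is added to an Arf semigroup.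

The characterization of MED semigroups comes from the atoms, the nonzero
elements that are not sums of two nonzero ones. They form the unique minimal
system of generators, and reduction modulo [m] is injective on them.

Every step down the tree lowers the multiplicity, which starts at [F + 1] and
stays positive, so some level is empty and the procedure stops there, with all
earlier levels, that is all of [Arf F], in its accumulator. *)

(** * Numerical semigroups and their multiplicity *)

Definition submonoid (S : set nat) : Prop :=
  S 0 /\ forall x y, S x -> S y -> S (x + y).

Lemma numerical_submonoid S : numerical_semigroup S -> submonoid S.
Proof. by case. Qed.

Lemma cofinite_natP (S : set nat) :
  finite_set (~` S) <-> exists N, forall n, N <= n -> S n.
Proof.
split=> [/finite_seqP[s Es]|[N HN]].
  exists (\max_(i <- s) i).+1 => n Hn; apply: contrapT => nS.
  have ns : n \in s by move: nS; rewrite -[~ S n]/((~` S) n) Es.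
  by have := @leq_bigmax_seq _ s xpredT id n ns isT; rewrite leqNgt Hn.
apply: (@sub_finite_set _ _ `I_N); last exact: finite_II.
by move=> n nS; rewrite /= ltnNge; apply/negP => /HN.
Qed.

Lemma nat_set_min (P : set nat) x :
  P x -> exists m, P m /\ forall y, P y -> m <= y.
Proof.
move=> Px; have ex : exists n, `[<P n>] by exists x; apply/asboolP.
case: (ex_minnP ex) => m /asboolP Pm min_m; exists m; split=> // y Py.
by apply: min_m; apply/asboolP.
Qed.

Lemma multiplicity_eq S m :
  (S `\ 0) m -> (forall s, (S `\ 0) s -> m <= s) -> multiplicity S = m.
Proof.
move=> Sm min_m; apply: xget_unique => [|y [Sy min_y]]; first by split.
by apply/eqP; rewrite eqn_leq min_m // min_y.
Qed.

Lemma multiplicityP S : numerical_semigroup S ->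
  (S `\ 0) (multiplicity S) /\ forall s, (S `\ 0) s -> multiplicity S <= s.
Proof.
case=> _ _ /cofinite_natP[N HN].
have /nat_set_min[m [Sm min_m]] : (S `\ 0) N.+1 by split=> //; apply: HN.
by rewrite (multiplicity_eq Sm min_m).
Qed.

Lemma multiplicity_gt0 S : numerical_semigroup S -> 0 < multiplicity S.
Proof. by case/multiplicityP => -[_ /= /eqP]; rewrite lt0n. Qed.

Lemma submonoid_muln S a k : submonoid S -> S a -> S (k * a).
Proof.
by case=> S0 SD Sa; elim: k => [|k IH] //; rewrite mulSn; apply: SD.
Qed.

(** * Generating sets and atoms *)

Lemma generated_submonoid X : submonoid (generated X).
Proof.
split; first by exists fset0, (fun=> 0); split; [|rewrite big_nil].
move=> x y [Y [l [YX ->]]] [Z [k [ZX ->]]].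
pose ext (W : {fset nat}) (f : nat -> nat) n := (n \in W) * f n.
have extE (W V : {fset nat}) f : (W `<=` V)%fset ->
    \sum_(n <- W) f n * n = \sum_(n <- V) ext W f n * n.
  move=> WV; rewrite -(big_fset_incl _ WV) => [|n _ nW].
    by apply: eq_big_seq => n nW; rewrite /ext nW mul1n.
  by rewrite /ext (negPf nW).
exists (Y `|` Z)%fset, (fun n => ext Y l n + ext Z k n); split.
  by move=> n; rewrite /= inE => /orP[/YX|/ZX].
rewrite (extE Y (Y `|` Z)%fset) ?fsubsetUl //.
rewrite (extE Z (Y `|` Z)%fset) ?fsubsetUr // -big_split /=.
by apply: eq_bigr => n _; rewrite mulnDl.
Qed.

Lemma sub_generated X : X `<=` generated X.
Proof.
move=> x Xx; exists [fset x]%fset, (fun=> 1); split.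
  by move=> n; rewrite /= inE => /eqP ->.
by rewrite big_seq_fset1 mul1n.
Qed.

Lemma generated_sub X S : submonoid S -> X `<=` S -> generated X `<=` S.
Proof.
move=> HS XS _ [Y [l [YX ->]]]; rewrite big_seq.
apply: (big_ind S) => [|x y|n nY]; [exact: HS.1|exact: HS.2|].
by apply: submonoid_muln => //; apply/XS/YX.
Qed.

Definition atoms (S : set nat) : set nat :=
  [set x | [/\ S x, x <> 0 & forall a b, S a -> S b -> x = a + b -> a = 0 \/ b = 0]].

Lemma atoms_multiplicity S : numerical_semigroup S -> atoms S (multiplicity S).
Proof.
move=> HS; have [[Sm m0] min_m] := multiplicityP HS; split=> // a b Sa Sb E.
have [a0|/eqP a0] := eqVneq a 0; [by left | right].
have := min_m a (conj Sa a0); lia.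
Qed.

(** An element that is not an atom is a sum of two smaller ones, so strong
induction applies. *)
Lemma generated_atoms S : submonoid S -> generated (atoms S) = S.
Proof.
move=> HS; apply/seteqP; split; first by apply: generated_sub => // x [].
have [G0 GD] := generated_submonoid (atoms S).
move=> x; elim/ltn_ind: x => x IH Sx.
have [->//|/eqP x0] := eqVneq x 0.
have [/sub_generated//|nat] := pselect (atoms S x).
apply: contrapT => nG; apply: nat; split=> // a b Sa Sb E.
have [->|/eqP a0] := eqVneq a 0; [by left | right].
apply: contrapT => b0; apply: nG; rewrite E.
by apply: GD; apply: IH => //; lia.
Qed.

(** Removing an atom [x] from [S] leaves a submonoid, so a subset of [S] that
misses [x] cannot generate [x]. *)
Lemma atoms_sub_generators S X :
  submonoid S -> generated X = S -> atoms S `<=` X.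
Proof.
move=> HS GX x [Sx x0 xirr]; apply: contrapT => nXx.
have HSx : submonoid (S `\ x).
  split; first by split=> [|/= E]; [exact: HS.1 | exact: x0].
  move=> a b [Sa ax] [Sb bx]; split=> [|/= E]; first exact: HS.2.
  have := xirr a b Sa Sb (esym E); move: ax bx => /=; lia.
have : (S `\ x) x; last by case=> _; apply.
have GXx : generated X x by rewrite GX.
apply: (generated_sub HSx _ GXx).
move=> y Xy; split=> [|/= E]; first by rewrite -GX; apply: sub_generated.
by apply: nXx; rewrite -E.
Qed.

Lemma minimal_generators_atoms S :
  submonoid S -> minimal_generators S (atoms S).
Proof.
move=> HS; split=> [|Y YA GY]; first exact: generated_atoms.
by apply/seteqP; split=> //; apply: atoms_sub_generators.
Qed.

Lemma msg_atoms S : submonoid S -> msg S = atoms S.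
Proof.
move=> HS; apply: xget_unique => [|X [GX minX]].
  exact: minimal_generators_atoms.
rewrite -(minX (atoms S)) //; last exact: generated_atoms.
exact: atoms_sub_generators.
Qed.

(** If [y < x], then [x - y] is a multiple of [m], so [x = y + (x - y)] would be a
decomposition of the atom [x]. *)
Lemma atom_least_mod S m x y : submonoid S -> S m -> m <> 0 ->
  atoms S x -> S y -> y <> 0 -> x = y %[mod m] -> x <= y.
Proof.
move=> HS Sm m0 [Sx x0 xirr] Sy y0 E; rewrite leqNgt; apply/negP => lt_yx.
move/eqP: E; rewrite eqn_mod_dvd ?(ltnW lt_yx) // => /dvdnP[k Ek].
case: (xirr y (x - y)) => //; try lia.
by rewrite Ek; apply: submonoid_muln.
Qed.

(** If [x - m] is past the conductor then it lies in [S], so [x] is not an atom. *)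
Lemma finite_atoms S : numerical_semigroup S -> finite_set (atoms S).
Proof.
move=> HS; have HM := numerical_submonoid HS.
have [[Sm m0] _] := multiplicityP HS; set m := multiplicity S in Sm m0.
case: (HS) => _ _ /cofinite_natP[N HN].
apply: (@sub_finite_set _ _ `I_(N.+1 + m)); last exact: finite_II.
move=> x Ax; rewrite /= ltnNge; apply/negP => Nx.
have : x <= x - m; last by move: m0 => /=; lia.
apply: (@atom_least_mod S m) => //; first by apply: HN; lia.
  by lia.
by rewrite -[in LHS](@subnK m x) ?modnDr //; lia.
Qed.

(** * Maximal embedding dimension *)

(** Reduction modulo the multiplicity [m] is injective on atoms, so there are
[m] of them exactly when every residue class contains one. *)
Lemma embedding_dim_multiplicityP S : numerical_semigroup S ->
  embedding_dim S = multiplicity S <->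
  forall z, exists2 x, atoms S x & x = z %[mod multiplicity S].
Proof.
move=> HS; have HM := numerical_submonoid HS.
have m_gt0 := multiplicity_gt0 HS.
have [[Sm m0] _] := multiplicityP HS.
rewrite /embedding_dim msg_atoms //; set m := multiplicity S in m_gt0 Sm m0 *.
set A := fset_set (atoms S).
have AP x : x \in A <-> atoms S x.
  by rewrite /A in_fset_set ?inE //; apply: finite_atoms.
pose res := [seq x %% m | x <- A].
have size_res : size res = #|` A| by rewrite size_map.
have uniq_res : uniq res.
  rewrite map_inj_in_uniq ?fset_uniq // => x y /AP Ax /AP Ay E.
  have [Sx x0 _] := Ax; have [Sy y0 _] := Ay.
  apply/eqP; rewrite eqn_leq.
  by rewrite (atom_least_mod HM Sm m0 Ax) // (atom_least_mod HM Sm m0 Ay).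
have sub_res : {subset res <= iota 0 m}.
  by move=> _ /mapP[x _ ->]; rewrite mem_iota add0n ltn_mod.
rewrite -size_res; split=> [Em z|surj].
  have le_size : size (iota 0 m) <= size res by rewrite size_iota Em.
  have [_ eq_res] := uniq_min_size uniq_res sub_res le_size.
  have : z %% m \in res by rewrite eq_res mem_iota ltn_mod.
  by case/mapP => x /AP Ax E; exists x.
rewrite -[RHS](size_iota 0); apply: perm_size.
apply: uniq_perm (iota_uniq _ _) _ => // r.
apply/idP/idP => [/sub_res //|]; rewrite mem_iota add0n => /= lt_rm.
have [x /AP Ax E] := surj r; apply/mapP; exists x => //.
by rewrite E modn_small.
Qed.

(** Given nonzero [a] and [b], the atom congruent to [a + b] lies strictly below
[a + b], which yields [a + b - m] in [S]. Conversely the least nonzero element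
of a residue class is an atom: if it were [a + b] with [a] and [b] nonzero,
hence both at least [m], then [a + b - m] would be a smaller nonzero element of
the class. *)
Lemma MED_semigroupP S : numerical_semigroup S ->
  MED_semigroup S <->
  forall a b, (S `\ 0) a -> (S `\ 0) b -> S (a + b - multiplicity S).
Proof.
move=> HS; have HM := numerical_submonoid HS.
have [[Sm m0] min_m] := multiplicityP HS.
have Am := atoms_multiplicity HS.
have -> : MED_semigroup S <-> embedding_dim S = multiplicity S.
  by split=> [[]|].
rewrite embedding_dim_multiplicityP //; set m := multiplicity S in Sm m0 min_m Am *.
split=> [surj a b [Sa a0] [Sb b0]|closed z].
  have [x Ax Ex] := surj (a + b); have [Sx x0 xirr] := Ax.
  have Sab : S (a + b) by apply: HM.2.
  have le_x : x <= a + b.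
    by apply: (atom_least_mod HM Sm) => //; move: a0 b0 => /=; lia.
  have neq_x : x <> a + b by case/(xirr a b Sa Sb).
  have /dvdnP[k Ek] : m %| a + b - x.
    by rewrite -eqn_mod_dvd //; apply/eqP.
  have -> : a + b - m = x + k.-1 * m.
    case: k Ek => [|k]; rewrite /= ?mulSn; lia.
  by apply: HM.2 => //; apply: submonoid_muln.
case: (HS) => _ _ /cofinite_natP[N HN].
pose P y := (S `\ 0) y /\ y = z %[mod m].
have /nat_set_min[w [[[Sw w0] Ew] min_w]] : P (z + N.+1 * m).
  have lt_N : N < N.+1 * m by rewrite leq_pmulr ?multiplicity_gt0.
  split; last by rewrite addnC modnMDl.
  by split=> /=; [apply: HN|]; lia.
exists w => //; split=> // a b Sa Sb E.
have [a0|/eqP a0] := eqVneq a 0; [by left | right].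
apply: contrapT => b0.
have le_ma : m <= a by apply: min_m.
have le_mb : m <= b by apply: min_m.
suff : w <= w - m by move: m0 w0 => /=; lia.
apply: min_w; split; last by rewrite -Ew -[in RHS](@subnK m w) ?modnDr //; lia.
by split=> [|/=]; [rewrite E; apply: closed | move: m0 => /=; lia].
Qed.

(** * Arf semigroups with a given Frobenius number *)

Lemma intset_Posz S n : intset S (Posz n) <-> S n.
Proof. by split=> [[k Sk [<-]]|Sn]; last exists n. Qed.

Lemma frobeniusP S F :
  frobenius S = Posz F <-> ~ S F /\ forall n, F < n -> S n.
Proof.
split=> [E|[nSF HF]].
  move: E; rewrite /frobenius; case: xgetP => // _ -> [nSF maxF] [] E.
  move: nSF maxF; rewrite E intset_Posz => nSF maxF; split=> // n lt_Fn.
  apply: contrapT => nSn; have := maxF n; rewrite intset_Posz => /(_ nSn); lia.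
apply: xget_unique => [|z [nSz maxz]].
  split=> [|[n|n] nSn]; rewrite ?intset_Posz //.
  have : ~ F < n by move=> /HF /intset_Posz.
  lia.
have := maxz F; rewrite intset_Posz => /(_ nSF).
case: z nSz maxz => [n|n] nSz _ le_Fz; last by lia.
have : ~ F < n by move=> /HF /intset_Posz.
lia.
Qed.

Lemma ArfP F S : Arf F S <-> [/\ A_semigroup S, ~ S F & forall n, F < n -> S n].
Proof.
rewrite /Arf /= frobeniusP; split=> [[? []]|[]] //.
Qed.

Lemma A_semigroup_MED S : A_semigroup S -> MED_semigroup S.
Proof.
move=> [HS HA]; apply/(MED_semigroupP HS) => a b Sa Sb.
have [[Sm _] min_m] := multiplicityP HS.
have [le_ab|/ltnW le_ba] := leqP a b.
  by rewrite addnC; apply: HA; [case: Sb|case: Sa| |rewrite min_m].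
by apply: HA; [case: Sa|case: Sb| |rewrite min_m].
Qed.

Lemma DeltaE F : Delta F = [set n | n = 0 \/ F < n].
Proof.
have [G0 GD] := generated_submonoid [set n | F.+1 <= n <= 2 * F + 1].
apply/seteqP; split=> n.
  apply: generated_sub => [|k /= /andP[lt_Fk _]]; last by right.
  by split=> [|x y /=]; [left | lia].
elim/ltn_ind: n => n IH [-> //|lt_Fn].
have [le_n|gt_n] := leqP n (2 * F + 1).
  by apply: sub_generated; rewrite /= lt_Fn.
rewrite -(@subnK F.+1 n) //; apply: GD; first by apply: IH => /=; lia.
by apply: sub_generated => /=; lia.
Qed.

Lemma multiplicity_Delta F : multiplicity (Delta F) = F.+1.
Proof.
rewrite DeltaE; apply: multiplicity_eq => [|s [/= ]].
  by split=> //=; right.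
by case.
Qed.

Lemma Delta_Arf F : 0 < F -> Arf F (Delta F).
Proof.
move=> F_gt0; apply/ArfP; rewrite DeltaE; split=> /= [||n]; last 2 first.
- by lia.
- by right.
split; last by move=> x y z /=; lia.
split; [by left|by move=> x y /=; lia|].
by apply/cofinite_natP; exists F.+1 => n; right.
Qed.

Lemma Arf_Delta F S : Arf F S -> F < multiplicity S -> S = Delta F.
Proof.
move=> /ArfP[[HS _] nSF HF] lt_Fm; have [_ min_m] := multiplicityP HS.
rewrite DeltaE; apply/seteqP; split=> n /= => [Sn|[->|/HF //]].
  have [->|/eqP n0] := eqVneq n 0; first by left.
  by right; apply: leq_trans lt_Fm (min_m n _).
by case: HS.
Qed.

Lemma multiplicity_theta F S x : numerical_semigroup S ->
  theta F S x -> multiplicity (S `|` [set x]) = x.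
Proof.
move=> HS [[[nSx _] _] lt_xm _ _]; have [_ min_m] := multiplicityP HS.
apply: multiplicity_eq => [|s [[Ss|->] s0]] //.
  split=> [|/= x0]; first by right.
  by apply: nSx; apply/intset_Posz; rewrite x0; case: HS.
by apply: ltnW; apply: leq_trans lt_xm (min_m s _).
Qed.

(** In the Arf condition for [S] with [x] added, the case where the least of the
three elements is [x] is the MED condition, and otherwise the larger two belong
to [S] as well. *)
Lemma theta_Arf F S x : Arf F S -> theta F S x -> Arf F (S `|` [set x]).
Proof.
move=> /ArfP[[HS HA] nSF HF] thx; have mT := multiplicity_theta HS thx.
have [_ lt_xm neq_xF [HT eT]] := thx.
have [_ min_m] := multiplicityP HS.
have /(MED_semigroupP HT) : MED_semigroup (S `|` [set x]) by [].
rewrite mT => closed.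
apply/ArfP; split=> [|[//|E]|n /HF]; [|by apply: neq_xF|by left].
split=> // a b c Ta Tb Tc le_cba.
have [->|/eqP c0] := eqVneq c 0; first by rewrite subn0; case: HT => _ + _; apply.
have x_gt0 : 0 < x by rewrite -mT; apply: multiplicity_gt0.
case: Tc => [Sc|Ex]; last by rewrite Ex; apply: closed; split=> //=; lia.
have lt_xc : x < c by apply: leq_trans lt_xm (min_m c _).
left; apply: HA => //.
  by case: Ta => [//|/= Ea]; lia.
by case: Tb => [//|/= Eb]; lia.
Qed.

(** The parent of [T] in the tree of Arf semigroups rooted at [Delta F] is [T]
without its multiplicity. *)
Lemma Arf_parent F T : Arf F T -> multiplicity T <= F ->
  exists S, [/\ Arf F S, theta F S (multiplicity T)
              & S `|` [set multiplicity T] = T].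
Proof.
move=> AT le_mF; have /ArfP[[HT HA] nTF HF] := AT.
have [[Tm m0] min_m] := multiplicityP HT; set m := multiplicity T in le_mF Tm m0 min_m *.
have [T0 TD] := numerical_submonoid HT.
have SP n : (T `\ m) n <-> T n /\ n <> m by split.
have lt_m n : T n -> n <> m -> n <> 0 -> m < n.
  by move=> Tn nm n0; have := min_m n (conj Tn n0); lia.
have Em : (T `\ m) `|` [set m] = T.
  apply/seteqP; split=> n; first by case=> [[]|->].
  by move=> Tn; have [->|/eqP nm] := eqVneq n m; [right|left].
have HS : numerical_semigroup (T `\ m).
  split.
  - by split=> //= E; apply: m0.
  - move=> x y [Tx xm] [Ty ym]; split=> [|/= E]; first exact: TD.
    by have := lt_m x Tx xm; have := lt_m y Ty ym; move: xm ym m0 => /=; lia.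
  - by apply/cofinite_natP; exists F.+1 => n lt_Fn; split=> [|/= E]; [apply: HF|lia].
have [[Tm' m'0] _] := multiplicityP HS.
exists (T `\ m); split=> //.
  apply/ArfP; split=> [|[]|n lt_Fn] //; last by split=> [|/= E]; [apply: HF|lia].
  split=> // x y z [Tx xm] [Ty ym] [Tz zm] le_zyx; split=> [|/= E]; first exact: HA.
  by have := lt_m x Tx xm; move: m0 xm => /=; lia.
split.
- split; last first.
    have -> : (2 * Posz m)%R = Posz (m + m) by lia.
    by apply/intset_Posz; split; [exact: TD | move: m0 => /=; lia].
  split=> [/intset_Posz[_]|s [[Ts sm] s0]]; first by apply.
  by rewrite -PoszD; apply/intset_Posz; split; [exact: TD | move: s0 => /=; lia].
- by case: Tm' => Tm' m'm; apply: lt_m.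
- by move=> E; apply: nTF; rewrite -E.
- by rewrite Em; apply: A_semigroup_MED.
Qed.

(** * Correctness of the procedure *)

Definition level F k : set (set nat) := iter k (extensions F) [set Delta F].

Definition levels_upto F k : set (set nat) :=
  [set S | exists2 i, i <= k & level F i S].

(** The bound on the multiplicity forces the levels past [F] to be empty. *)
Lemma level_Arf F k S : 0 < F -> level F k S ->
  Arf F S /\ multiplicity S + k <= F.+1.
Proof.
move=> F_gt0; elim: k S => [_ ->|k IH _ [S /IH[AS le_m] [x thx <-]]].
  by rewrite multiplicity_Delta addn0; split=> //; apply: Delta_Arf.
have /ArfP[[HS _] _ _] := AS.
split; first exact: theta_Arf.
by rewrite (multiplicity_theta HS thx); case: thx => _; lia.
Qed.

(** Induction on [F + 1 - multiplicity S], which drops on passing to the parent. *)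
Lemma Arf_level F S : Arf F S -> exists k, level F k S.
Proof.
have [n] := ubnP (F.+1 - multiplicity S).
elim: n S => // n IH T le_n AT; have [lt_Fm|le_mF] := ltnP F (multiplicity T).
  by exists 0; apply: Arf_Delta.
have [S [AS thm ET]] := Arf_parent AT le_mF.
case: (IH S _ AS) => [|k Sk]; first by case: thm => _; lia.
by exists k.+1, S => //; exists (multiplicity T).
Qed.

Lemma level_empty_ge F k j : level F k = set0 -> k <= j -> level F j = set0.
Proof.
move=> Ek; elim: j => [|j IH]; first by rewrite leqn0 => /eqP <-.
rewrite leq_eqVlt ltnS => /orP[/eqP <- //|/IH Ej].
by rewrite /level iterS -/(level F j) Ej /extensions bigcup_set0.
Qed.

Lemma theta_level_emptyP F k :
  \bigcup_(S in level F k) theta F S = set0 <-> level F k.+1 = set0.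
Proof.
split=> E; rewrite -subset0.
  move=> T [S Sk [x thx _]].
  by have : (\bigcup_(S in level F k) theta F S) x; [exists S | rewrite E].
move=> x [S Sk thx].
by have : level F k.+1 (S `|` [set x]); [exists S => //; exists x | rewrite E].
Qed.

Lemma levels_uptoS F k :
  levels_upto F k `|` level F k.+1 = levels_upto F k.+1.
Proof.
apply/seteqP; split=> S.
  by case=> [[i le_ik Si]|]; [exists i; rewrite // ltnW|exists k.+1].
case=> i; rewrite leq_eqVlt ltnS => /orP[/eqP -> Si|le_ik Si]; [by right|].
by left; exists i.
Qed.

Lemma levels_upto_Arf F k : 0 < F -> level F k.+1 = set0 ->
  levels_upto F k = Arf F.
Proof.
move=> F_gt0 Ek; apply/seteqP; split=> S; first by case=> i _ /(level_Arf F_gt0)[].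
move=> /Arf_level[i Si]; exists i => //; rewrite leqNgt; apply/negP => lt_ki.
by move: Si; rewrite (level_empty_ge Ek lt_ki).
Qed.

(** At the head of the loop, the two variables are always the union of the first
levels and the last of these levels, so the value returned does not depend on
the execution. *)
Lemma run_Arf F k R : 0 < F ->
  run F (levels_upto F k) (level F k) R -> R = Arf F.
Proof.
move=> F_gt0; move EA : (levels_upto F k) => A; move EB : (level F k) => B runR.
elim: runR k EA EB => {A B R} [A B E|A B R M _ _ _ IH] k EA EB.
  by rewrite -EA; apply: levels_upto_Arf => //; apply/theta_level_emptyP; rewrite EB.
by apply: (IH k.+1); rewrite -?levels_uptoS -?EA -?EB.
Qed.

Lemma Arf_run F k : 0 < F -> run F (levels_upto F k) (level F k) (Arf F).
Proof.
move=> F_gt0; have [n] := ubnP (F.+1 - k); elim: n k => // n IH k le_n.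
have [Ek|nEk] := pselect (level F k.+1 = set0).
  by rewrite -(levels_upto_Arf F_gt0 Ek); apply: run_return; apply/theta_level_emptyP.
have lt_k : k < F.+1.
  rewrite ltnNge; apply/negP => le_Fk; apply: nEk; rewrite -subset0 => S Sk.
  have [/ArfP[[HS _] _ _]] := level_Arf F_gt0 Sk.
  by have := multiplicity_gt0 HS; lia.
apply: (@run_loop _ _ _ _ (fun S => fset_set (atoms S))).
- by move=> /theta_level_emptyP.
- move=> S Sk; have [/ArfP[[HS _] _ _] _] := @level_Arf F k.+1 S F_gt0 Sk.
  rewrite fset_setK; last exact: finite_atoms.
  by apply: minimal_generators_atoms; apply: numerical_submonoid.
- by rewrite -[extensions F _]/(level F k.+1) levels_uptoS; apply: IH; lia.
Qed.

Theorem mainTheorem3 (F : nat) (hF : 0 < F) (R : set (set nat)) :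
  returns F R <-> R = Arf F.
Proof.
have E0 : levels_upto F 0 = [set Delta F].
  apply/seteqP; split=> S; first by case=> i; rewrite leqn0 => /eqP ->.
  by exists 0.
rewrite /returns -[X in run F X]E0 -[X in run F _ X]/(level F 0).
by split=> [/(run_Arf hF)|->]; last exact: Arf_run.
Qed.
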